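(* Let $S$ be a finite nonempty set, let $\chi:S^n\to S^n$ be a bijective block rule and let $f:S^{\mathbb Z}\to S^{\mathbb Z}$ be a cellular automaton. The slider relation defined by $\chi$ is equal to (the graph of) $f$ if and only if the sweeper relation defined by $\chi$ is equal to (the graph of) $f$.
   Context: $S^{\mathbb Z}$ carries the product topology; a cellular automaton is a continuous map $S^{\mathbb Z}\to S^{\mathbb Z}$ commuting with the shift $\sigma(x)_i=x_{i+1}$. A block rule is a function $\chi:S^n\to S^n$ ($n\ge1$). For $i\in\mathbb Z$, $\chi^i:S^{\mathbb Z}\to S^{\mathbb Z}$ applies $\chi$ at coordinate $i$: $\chi^i(x)_{[i,i+n)}=\chi(x_{[i,i+n)})$, and all other coordinates are unchanged. Define $\chi^{i+}(x)=\lim_{j\to\infty}\chi^{j}\circ\chi^{j-1}\circ\cdots\circ\chi^{i}(x)$ and, for a block rule $\xi$, $\xi^{i-}(x)=\lim_{j\to-\infty}\xi^{j}\circ\cdots\circ\xi^{i-2}\circ\xi^{i-1}(x)$; these limits always exist. Slider relation: if $\chi$ is bijective with inverse $\xi$, the set of pairs $(y,z)\in S^{\mathbb Z}\times S^{\mathbb Z}$ such that for some $x\in S^{\mathbb Z}$ and $i\in\mathbb Z$, $\xi^{i-}(x)=y$ and $\chi^{i+}(x)=z$. Sweeper relation: the set of pairs $(y,z)\in S^{\mathbb Z}\times S^{\mathbb Z}$ such that some subsequence of $\chi^{0+}(y),\chi^{-1+}(y),\chi^{-2+}(y),\dots$ converges to $z$ (here $\chi^{-k+}$ means $\chi^{i+}$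 with $i=-k$). *)

(* Defs.v *)
From HB Require Import structures.
From mathcomp Require Import all_boot all_order all_algebra.
From mathcomp Require Import zify.
From mathcomp Require Import all_classical topology function_spaces.

Set Implicit Arguments.
Unset Strict Implicit.
Unset Printing Implicit Defensive.

Import Order.TTheory GRing.Theory Num.Theory.
Local Open Scope classical_set_scope.
Local Open Scope ring_scope.

(* The topology must be put on an alias: the library's default topology on the
   bare function type [int -> S] is not the product topology. *)
Definition config (S : finType) : Type := {ptws int -> discrete_topology S}.

HB.instance Definition _ (S : finType) := Choice.on (config S).
HB.instance Definition _ (S : finType) := Nbhs.on (config S).
HB.instance Definition _ (S : finType) := Topological.on (config S).

Definition shift (S : finType) (x : config S) : config S :=
  fun i => x (i + 1).

Definition cellular_automaton (S : finType) (f : config S -> config S) : Prop :=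
  continuous f /\ (forall x, f (shift x) = shift (f x)).

Section Blocks.
Variables (S : finType) (n : nat).
Implicit Types (chi : n.-tuple S -> n.-tuple S) (x y z : config S) (i j : int).

Definition window x i : n.-tuple S := [tuple (x (i + k%:Z) : S) | k < n].

(* The default value [x j] of [nth] is never used, as [`|j - i| < n] there. *)
Definition apply_at chi i x : config S := fun j =>
  if i <= j < i + n%:Z then nth (x j : S) (chi (window x i)) `|j - i|%N
  else x j.

Fixpoint sweep_right chi i x (m : nat) : config S :=
  if m is p.+1 then apply_at chi (i + p%:Z) (sweep_right chi i x p) else x.

Fixpoint sweep_left chi i x (m : nat) : config S :=
  if m is p.+1 then apply_at chi (i - p.+1%:Z) (sweep_left chi i x p) else x.

(* The library's [lim] requires a pointed type, hence [xget], whose default [x]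
   is never used: the limits exist ([sweep_right_limP], [sweep_left_limP]) and are
   unique ([config_hausdorff]). *)
Definition sweep_right_lim chi i x : config S :=
  xget x [set z | sweep_right chi i x @ \oo --> z].

Definition sweep_left_lim chi i x : config S :=
  xget x [set z | sweep_left chi i x @ \oo --> z].

Definition inverse_rule chi (chi_bij : bijective chi) :
  n.-tuple S -> n.-tuple S := invF (bij_inj chi_bij).

Definition slider_relation chi (chi_bij : bijective chi) :
  set (config S * config S) :=
  [set yz | exists x i, sweep_left_lim (inverse_rule chi_bij) i x = yz.1
                     /\ sweep_right_lim chi i x = yz.2].

Definition sweeper_relation chi : set (config S * config S) :=
  [set yz | exists phi : nat -> nat, {homo phi : a b / (a < b)%N} /\
    (fun k => sweep_right_lim chi (- (phi k)%:Z) yz.1) @ \oo --> yz.2].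

End Blocks.

Definition graph (S : finType) (f : config S -> config S) :
  set (config S * config S) := [set yz | yz.2 = f yz.1].

Section LimitsExist.
Variables (S : finType) (n : nat).
Implicit Types (chi : n.-tuple S -> n.-tuple S) (x : config S) (i : int).

Lemma config_cvgP (u : nat -> config S) (z : config S) :
  u @ \oo --> z <-> forall j, \forall m \near \oo, u m j = z j.
Proof.
rewrite (pointwise_cvgP (U := discrete_topology int) (V := discrete_topology S)); split=> h j.
  have := h j [set z j]; apply; exact/principal_filterP.
move=> A /principal_filterP zA.
by apply: (filterS _ (h j)) => m /= ->.
Qed.

Lemma config_hausdorff : hausdorff_space (config S).
Proof.
by apply: (@hausdorff_product int (fun=> discrete_topology S)) => _;
  exact: discrete_hausdorff.
Qed.

Lemma sweep_right_limP chi i x :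
  sweep_right chi i x @ \oo --> sweep_right_lim chi i x.
Proof.
apply: (@xgetPex _ x [set z | sweep_right chi i x @ \oo --> z]).
exists (fun j => sweep_right chi i x `|j - i|.+1 j); apply/config_cvgP => j.
exists `|j - i|.+1 => // m /= /subnKC <-.
elim: (m - _)%N => [|d IH]; rewrite ?addn0 // addnS /= -IH {1}/apply_at.
case: ifP => // /andP[+ _]; lia.
Qed.

Lemma sweep_left_limP chi i x :
  sweep_left chi i x @ \oo --> sweep_left_lim chi i x.
Proof.
apply: (@xgetPex _ x [set z | sweep_left chi i x @ \oo --> z]).
exists (fun j => sweep_left chi i x (`|i - j| + n)%N j); apply/config_cvgP => j.
exists (`|i - j| + n)%N => // m /= /subnKC <-.
elim: (m - _)%N => [|d IH]; rewrite ?addn0 // addnS /= -IH {1}/apply_at.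
case: ifP => // /andP[_]; lia.
Qed.

End LimitsExist.

(* Main.v *)
(* One inclusion, sweeper in slider, is compactness: the configurations
   chi^(-1) o ... o chi^(-k) (y) have a convergent subsequence, whose limit
   witnesses the slider relation.  As the sweeper relation is total, again by
   compactness, it equals the graph of f as soon as the slider relation does.

   For the converse, view the rightward sweep as a transducer whose states are
   the words in the current window.  Bijectivity of chi makes the preimages of a
   set X of states under all the input letters have average size #|X|.  If some
   state at position c leads to a symbol other than (f y)_j at j, then an input
   word whose preimage of the set of such bad states is as large as possible keeps
   a nonempty preimage under all its left extensions.  This lets one build a
   left-infinite input having infinitely many starting points from which the sweep
   produces the wrong symbol at j, against the sweeper relation being the graph
   of f.  So no state at c is bad, which determines the output of every slider. *)
Require Import Defs.
From mathcomp Require Import all_boot all_order all_algebra.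
From mathcomp Require Import zify.
From mathcomp Require Import all_classical topology function_spaces.

Set Implicit Arguments.
Unset Strict Implicit.
Unset Printing Implicit Defensive.

Import Order.TTheory GRing.Theory Num.Theory.

(** * Counting preimages in a reversible transducer *)

Section Transducer.
Variables (A Q : finType) (step : Q -> A -> Q) (out : Q -> A -> A).
Hypothesis step_inj : injective (fun qa => (out qa.1 qa.2, step qa.1 qa.2)).

(** An injection between finite sets of equal size, (state, letter) to (output, next state) is a
    bijection. The pairs entering [X] are the preimage of all outputs times [X]; the left side
    counts them letter by letter. *)
Lemma sum_card_step_preim (X : {set Q}) :
  (\sum_(a : A) #|[set q | step q a \in X]| = \sum_(a : A) #|X|)%N.
Proof.
pose h (qa : Q * A) := (out qa.1 qa.2, step qa.1 qa.2).
have hbij : bijective h.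
  by apply: inj_card_bij step_inj _; rewrite !card_prod mulnC.
transitivity #|[set qa : Q * A | step qa.1 qa.2 \in X]|.
  rewrite -sum1_card (partition_big snd predT) //=.
  apply: eq_bigr => a _; rewrite -sum1_card.
  rewrite (reindex_onto (fun q => (q, a)) fst) /=.
    by apply: eq_bigl => q; rewrite !inE !eqxx /= !andbT.
  by move=> [q a'] /andP[_ /eqP /= ->].
have -> : [set qa : Q * A | step qa.1 qa.2 \in X] = h @^-1: finset.setX finset.setT X.
  by apply/setP => -[q a]; rewrite !inE.
rewrite on_card_preimset; last by exact: onW_bij.
by rewrite cardsX cardsT sum_nat_const.
Qed.

(** Take [w0] maximizing the number [N] of states that it sends into [X]; [N] is positive because
    the empty word gives [X] itself. Extending [w0] to the left never changes this number. *)
Lemma persistent_word (X : {set Q}) : X != finset.set0 ->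
  exists w0 : seq A, forall w, exists q, foldl step q (w ++ w0) \in X.
Proof.
move=> X0; pose P w := [set q | foldl step q w \in X].
pose size_attained m := `[< exists w, #|P w| = m >].
have ex : exists m, size_attained m by exists #|P [::]|; apply/asboolP; exists [::].
have ub m : size_attained m -> (m <= #|Q|)%N.
  by move=> /asboolP[w <-]; exact: max_card.
case: (ex_maxnP ex ub) => N /asboolP[w0 w0N] Nmax.
have leN w : (#|P w| <= N)%N by apply: Nmax; apply/asboolP; exists w.
have N0 : (0 < N)%N.
  apply: leq_trans (leN [::]); rewrite (_ : P [::] = X) ?card_gt0 //.
  by apply/setP => q; rewrite inE.
exists w0 => w; suff : (0 < #|P (w ++ w0)|)%N.
  by rewrite card_gt0 => /set0Pn[q]; rewrite inE; exists q.
suff -> : #|P (w ++ w0)| = N by [].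
elim: w => [//|a w IH].
have PE b : P (b :: w ++ w0) = [set q | step q b \in P (w ++ w0)].
  by apply/setP => q; rewrite !inE.
have := sum_card_step_preim (P (w ++ w0)).
rewrite IH; under eq_bigr do rewrite -PE.
(* No term exceeds [N] and their average is [N], so each equals [N]. *)
have leqN (b : A) : predT b ->
    #|P (b :: w ++ w0)| <= N ?= iff (#|P (b :: w ++ w0)| == N) by [].
by move=> /eqP; rewrite (leqif_sum leqN).2 => /forall_inP/(_ a isT)/eqP.
Qed.

End Transducer.

(** * Compactness and continuity in the space of configurations *)

Local Open Scope classical_set_scope.
Local Open Scope ring_scope.

Lemma config_nbhs_cylinder (S : finType) (x : config S) (N : nat) :
  nbhs x [set y : config S | forall j : int, `|j| <= N%:Z -> y j = x j].
Proof.
have coord (j : int) : \forall y \near x, y j = x j.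
  have /(pointwise_cvgP (U := discrete_topology int)
    (V := discrete_topology S)) h : nbhs x --> x by exact: cvg_id.
  have := h j [set x j]; apply; exact/principal_filterP.
have : \forall y \near x, forall k : 'I_(N + N).+1,
    (y : config S) (k%:Z - N%:Z) = x (k%:Z - N%:Z).
  apply: (@filter_forall _ _ (fun (k : 'I_(N + N).+1) (y : config S) =>
    y (k%:Z - N%:Z) = x (k%:Z - N%:Z)) (nbhs x) _) => k.
  exact: coord.
apply: filterS => y yx j jN.
have kN : (`|(j + N%:Z)%R| < (N + N).+1)%N by lia.
have := yx (Ordinal kN); rewrite /=.
by have -> : `|(j + N%:Z)%R|%N%:Z - N%:Z = j by lia.
Qed.

(** Tychonoff gives a cluster point [z]; [psi] picks ever later indices, with [u (psi t)] equal to
    [z] on [[-t, t]]. *)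
Lemma config_cvg_subseq (S : finType) (u : nat -> config S) :
  exists (psi : nat -> nat) (z : config S),
    {homo psi : a b / (a < b)%N} /\ u \o psi @ \oo --> z.
Proof.
have : compact [set g : config S | forall j : int, [set: discrete_topology S] (g j)].
  apply: (@tychonoff int (fun=> discrete_topology S) (fun=> setT)) => _.
  by apply: finite_compact; apply: (@finite_finset S).
move=> /(_ (u @ \oo)) [|z [_ clu]]; first by apply: filterE.
have step (Nm : nat * nat) : exists k, (Nm.2 < k)%N /\
    forall j : int, `|j| <= Nm.1%:Z -> u k j = z j.
  case: Nm => N m /=.
  have mu : (u @ \oo) [set y | exists2 k, (m < k)%N & y = u k].
    by exists m.+1 => // k /= mk; exists k.
  by have [_ [[k mk ->] uz]] := clu _ _ mu (config_nbhs_cylinder z N); exists k.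
have [g gP] := choice step.
pose psi := fix psi t := if t is t'.+1 then g (t, psi t') else g (0, 0)%N.
have psiz t (j : int) : `|j| <= t%:Z -> u (psi t) j = z j.
  by case: t => [|t]; move: j; [exact: (gP (0, 0)%N).2 | exact: (gP (t.+1, psi t)).2].
exists psi, z; split.
  by apply: homo_ltn; [exact: ltn_trans | move=> t; exact: (gP (t.+1, psi t)).1].
apply/config_cvgP => j; exists `|j|%N => // t /= jt.
by apply: psiz; lia.
Qed.

Lemma config_cvg_unique (S : finType) (u : nat -> config S) (x y : config S) :
  u @ \oo --> x -> u @ \oo --> y -> x = y.
Proof. by move=> ux uy; apply: (cvg_unique (@config_hausdorff S) ux uy). Qed.

Lemma leq_increasing (k : nat -> nat) :
  {homo k : a b / (a < b)%N} -> forall m, (m <= k m)%N.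
Proof. by move=> kP; elim=> [//|m IH]; apply: leq_ltn_trans IH _; exact: kP. Qed.

Lemma cvg_subseq_index (T : topologicalType) (u : nat -> T) (z : T) (k : nat -> nat) :
  {homo k : a b / (a < b)%N} -> u @ \oo --> z -> u \o k @ \oo --> z.
Proof.
move=> kP uz; apply: cvg_comp uz => A [N _ NA]; exists N => // m /= Nm.
by apply: NA; exact: leq_trans Nm (leq_increasing kP m).
Qed.

(** The half-line form suits configurations altered only far to the left. Counterexamples for every
    [r] would converge to [y]. *)
Lemma config_continuous_tail (S : finType) (f : config S -> config S) :
  continuous f -> forall (y : config S) (j : int), exists r : nat,
  forall x, (forall l, - r%:Z <= l -> x l = y l) -> f x j = f y j.
Proof.
move=> fc y j; apply: contrapT => h.
have nx (r : nat) : exists x : config S,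
    (forall l, - r%:Z <= l -> x l = y l) /\ f x j <> f y j.
  apply: contrapT => hr; apply: h; exists r => x xy.
  by apply: contrapT => fxy; apply: hr; exists x.
have [u uP] := choice nx.
have uy : u @ \oo --> y.
  apply/config_cvgP => l; exists `|l|%N => // r /= lr.
  by apply: (uP r).1; lia.
have /config_cvgP /(_ j) : f \o u @ \oo --> f y by apply: cvg_comp uy (fc y).
by move=> [N _ /(_ N (leqnn N))] /=; exact: (uP N).2.
Qed.

(** * Inverting, splitting and passing to the limit in sweeps *)

Section Sweeps.
Variables (S : finType) (n : nat).
Implicit Types (chi xi : n.-tuple S -> n.-tuple S) (x y z : config S) (i j : int).

Lemma window_apply_at chi i x : window n (apply_at chi i x) i = chi (window n x i).
Proof.
apply: eq_from_tnth => k; rewrite tnth_mktuple /apply_at (tnth_nth (x (i + k%:Z))).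
have -> : i <= i + k%:Z < i + n%:Z by have := ltn_ord k; lia.
by congr nth; lia.
Qed.

Lemma apply_at_out chi i x j : ~~ (i <= j < i + n%:Z) -> apply_at chi i x j = x j.
Proof. by rewrite /apply_at => /negbTE ->. Qed.

Lemma apply_atK chi xi i : cancel chi xi -> cancel (apply_at chi i) (apply_at xi i).
Proof.
move=> chiK x; apply/funext => j.
case: (boolP (i <= j < i + n%:Z)) => ij; last by rewrite !apply_at_out.
rewrite {1}/apply_at ij window_apply_at chiK.
have jn : (`|(j - i)%R| < n)%N by lia.
rewrite -(tnth_nth _ _ (Ordinal jn)) tnth_mktuple /=; congr x; lia.
Qed.

Lemma apply_at_cvg chi i (u : nat -> config S) x :
  u @ \oo --> x -> (fun m => apply_at chi i (u m)) @ \oo --> apply_at chi i x.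
Proof.
move=> /config_cvgP ux; apply/config_cvgP => j.
have : \forall m \near \oo, forall k : 'I_n, u m (i + k%:Z) = x (i + k%:Z).
  by apply: filter_forall => k; exact: ux.
move: (ux j); apply: filterS2 => m uj uw.
rewrite /apply_at uj (_ : window n (u m) i = window n x i) //.
by apply: eq_from_tnth => k; rewrite !tnth_mktuple.
Qed.

Lemma sweep_rightS chi i x p :
  sweep_right chi i x p.+1 = sweep_right chi (i + 1) (apply_at chi i x) p.
Proof.
elim: p => [|p IH]; first by rewrite /= addr0.
rewrite -[LHS]/(apply_at chi (i + p.+1%:Z) (sweep_right chi i x p.+1)) IH /=.
by congr apply_at; lia.
Qed.

Lemma sweep_leftS chi i x p :
  sweep_left chi i x p.+1 = sweep_left chi (i - 1) (apply_at chi (i - 1) x) p.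
Proof.
elim: p => [|p IH] //.
rewrite -[LHS]/(apply_at chi (i - p.+2%:Z) (sweep_left chi i x p.+1)) IH /=.
by congr apply_at; lia.
Qed.

Lemma sweep_rightD chi i x p q :
  sweep_right chi i x (p + q) = sweep_right chi (i + p%:Z) (sweep_right chi i x p) q.
Proof.
elim: q => [|q IH]; first by rewrite addn0.
rewrite addnS /= IH; congr apply_at; lia.
Qed.

Lemma sweep_leftK chi xi i x p : cancel xi chi ->
  sweep_right chi (i - p%:Z) (sweep_left xi i x p) p = x.
Proof.
move=> xiK; elim: p => [|p IH] //.
rewrite sweep_rightS /= apply_atK // -[RHS]IH; congr sweep_right; lia.
Qed.

Lemma sweep_rightK chi xi i x p : cancel chi xi ->
  sweep_left xi (i + p%:Z) (sweep_right chi i x p) p = x.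
Proof.
move=> chiK; elim: p => [|p IH] //.
rewrite sweep_leftS /= (_ : i + p.+1%:Z - 1 = i + p%:Z); last lia.
by rewrite apply_atK.
Qed.

Lemma sweep_right_limE chi i x j p : j < i + p%:Z ->
  sweep_right_lim chi i x j = sweep_right chi i x p j.
Proof.
move=> jp; have := @sweep_right_limP S n chi i x.
move=> /config_cvgP /(_ j) [N _ /(_ (p + N)%N (leq_addl _ _))] /= <-.
elim: N => [|N IH]; rewrite ?addn0 // addnS /= apply_at_out //; lia.
Qed.

(** The next application acts at [i - p.+1] and reaches only coordinates below [i - p.+1 + n], so
    [j] is final after [p] steps. *)
Lemma sweep_left_limE chi i x j p : i + n%:Z <= j + p.+1%:Z ->
  sweep_left_lim chi i x j = sweep_left chi i x p j.
Proof.
move=> jp; have := @sweep_left_limP S n chi i x.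
move=> /config_cvgP /(_ j) [N _ /(_ (p + N)%N (leq_addl _ _))] /= <-.
elim: N => [|N IH]; rewrite ?addn0 // addnS /= apply_at_out //; lia.
Qed.

Lemma sweep_right_limD chi i x p :
  sweep_right_lim chi i x = sweep_right_lim chi (i + p%:Z) (sweep_right chi i x p).
Proof.
apply/funext => j; pose q := `|(j - (i + p%:Z))%R|%N.+1.
rewrite (@sweep_right_limE _ _ _ _ (p + q)); last by rewrite /q; lia.
by rewrite sweep_rightD (@sweep_right_limE _ _ _ _ q) //; rewrite /q; lia.
Qed.

(** Each coordinate is settled after a number of steps that does not depend on the configuration. *)
Lemma sweep_right_lim_cvg chi i (u : nat -> config S) x : u @ \oo --> x ->
  (fun m => sweep_right_lim chi i (u m)) @ \oo --> sweep_right_lim chi i x.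
Proof.
move=> ux; have uxp p :
    (fun m => sweep_right chi i (u m) p) @ \oo --> sweep_right chi i x p.
  by elim: p => [//|p IH]; exact: apply_at_cvg.
apply/config_cvgP => j; have jp : j < i + `|j - i|.+1%:Z by lia.
have /config_cvgP /(_ j) := uxp `|j - i|.+1.
by apply: filterS => m; rewrite !(sweep_right_limE _ _ jp).
Qed.

Lemma sweep_left_lim_cvg chi i (u : nat -> config S) x : u @ \oo --> x ->
  (fun m => sweep_left_lim chi i (u m)) @ \oo --> sweep_left_lim chi i x.
Proof.
move=> ux; have uxp p :
    (fun m => sweep_left chi i (u m) p) @ \oo --> sweep_left chi i x p.
  by elim: p => [//|p IH]; exact: apply_at_cvg.
apply/config_cvgP => j; have jp : i + n%:Z <= j + (`|i - j| + n).+1%:Z by lia.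
have /config_cvgP /(_ j) := uxp (`|i - j| + n)%N.
by apply: filterS => m; rewrite !(sweep_left_limE _ _ jp).
Qed.

End Sweeps.

(** * From sweepers to sliders by compactness *)

Section Relations.
Variables (S : finType) (n : nat) (chi : n.-tuple S -> n.-tuple S).
Implicit Types (x y z : config S) (k : nat -> nat).

(** Freedom in [k] serves twice: the identity gives totality, and a sequence of faulty starting
    points gives the final contradiction. *)
Lemma sweeper_subseq y k : {homo k : a b / (a < b)%N} ->
  exists2 psi : nat -> nat, {homo psi : a b / (a < b)%N} &
  exists2 z, sweeper_relation chi (y, z) &
    (fun t => sweep_right_lim chi (- (k (psi t))%:Z) y) @ \oo --> z.
Proof.
move=> kP.
have [psi [z [psiP uz]]] :=
  config_cvg_subseq (fun t => sweep_right_lim chi (- (k t)%:Z) y).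
exists psi => //; exists z => //.
by exists (k \o psi); split=> // a b ab; apply/kP/psiP.
Qed.

Lemma sweeper_total y : exists z, sweeper_relation chi (y, z).
Proof. by have [|_ _ [z yz _]] := @sweeper_subseq y id; [move=> ? ? | exists z]. Qed.

Lemma sweeper_sub_slider (chi_bij : bijective chi) :
  sweeper_relation chi `<=` slider_relation chi_bij.
Proof.
move=> [y z] [phi [phiP /= uz]].
(* The sweep is cut at 0: going back left from [x t] recovers [y], going on right from it completes
   the sweep. *)
pose x t := sweep_right chi (- (phi t)%:Z) y (phi t).
have [psi [w [psiP xw]]] := config_cvg_subseq x.
exists w, 0; split => /=.
  apply: (config_cvg_unique
    (@sweep_left_lim_cvg _ _ (inverse_rule chi_bij) 0 _ _ xw)).
  apply/config_cvgP => j; exists (`|j| + n)%N => // t /= jt.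
  rewrite (@sweep_left_limE _ _ _ _ _ _ (phi (psi t))).
    have := sweep_rightK (- (phi (psi t))%:Z) y (phi (psi t))
      (invF_f (bij_inj chi_bij)).
    by rewrite addNr => ->.
  by have := leq_increasing (fun _ _ ab => phiP _ _ (psiP _ _ ab)) t; rewrite /=; lia.
apply: (config_cvg_unique (@sweep_right_lim_cvg _ _ chi 0 _ _ xw)).
suff -> : (fun m => sweep_right_lim chi 0 ((x \o psi) m)) =
  (fun t => sweep_right_lim chi (- (phi t)%:Z) y) \o psi by exact: cvg_subseq_index.
apply/funext => t /=.
by rewrite [RHS](sweep_right_limD _ _ _ (phi (psi t))) addNr.
Qed.

End Relations.

(** * Finite words read from configurations *)

Definition segment (S : finType) (x : config S) (i : int) (p : nat) : seq S :=
  [seq (x (i + k%:Z) : S) | k <- iota 0 p].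

Lemma size_segment (S : finType) (x : config S) (i : int) (p : nat) :
  size (segment x i p) = p.
Proof. by rewrite size_map size_iota. Qed.

Lemma segmentD (S : finType) (x : config S) (i : int) (p q : nat) :
  segment x i (p + q) = segment x i p ++ segment x (i + p%:Z) q.
Proof.
rewrite /segment iotaD map_cat -[(0 + p)%N]addn0 iotaDl -map_comp; congr cat.
by apply: eq_map => k /=; congr (x _); lia.
Qed.

Lemma window_segment (S : finType) (n : nat) (x : config S) (i : int) :
  window n x i = segment x i n :> seq S.
Proof. by rewrite /= /segment -val_enum_ord -map_comp. Qed.

Lemma eq_segment (S : finType) (x y : config S) (i : int) (p : nat) :
  (forall j, i <= j -> x j = y j) -> segment x i p = segment y i p.
Proof. by move=> xy; apply: eq_map => k; rewrite xy //; lia. Qed.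

Lemma leq_size_extension (T : Type) (w s : nat -> seq T) :
  (forall t, w t.+1 = s t ++ w t) -> (forall t, 0 < size (s t))%N ->
  forall t, (t <= size (w t))%N.
Proof.
by move=> wS s0; elim=> [//|t IH]; rewrite wS size_cat; have := s0 t; lia.
Qed.

Lemma left_infinite_word (S : finType) (a : S) (c : int) (y : config S)
    (w s : nat -> seq S) :
  (forall t, w t.+1 = s t ++ w t) -> (forall t, 0 < size (s t))%N ->
  exists x : config S, (forall j, c <= j -> x j = y j) /\
    forall t, segment x (c - (size (w t))%:Z) (size (w t)) = w t.
Proof.
(* Letters are numbered from the right end, which all [w t] share. As [w k.+1] has more than [k]
   letters, the default [a] is not reached. *)
move=> wS s0; pose letter (k : nat) := nth a (rev (w k.+1)) k.
have size_w := leq_size_extension wS s0.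
have letterE t k : (k < size (w t))%N -> nth a (rev (w t)) k = letter k.
  have mono u d : (k < size (w u))%N ->
      nth a (rev (w (u + d)%N)) k = nth a (rev (w u)) k.
    move=> ku; elim: d => [|d IH]; first by rewrite addn0.
    rewrite addnS wS rev_cat nth_cat size_rev IH.
    suff -> : (k < size (w (u + d)))%N by [].
    apply: leq_trans ku _; elim: d {IH} => [|d IH]; first by rewrite addn0.
    by rewrite addnS wS size_cat; lia.
  move=> kt; have := mono t k.+1 kt; rewrite addnC /letter => <-.
  by apply: mono; exact: size_w.
exists (fun j => if c <= j then y j else letter `|c - j|.-1); split.
  by move=> j ->.
move=> t; apply: (@eq_from_nth _ a) => [|k]; rewrite size_segment // => kt.
rewrite (nth_map 0%N) ?size_iota // nth_iota // add0n.
have -> : (c <= c - (size (w t))%:Z + k%:Z) = false by lia.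
rewrite -(letterE t); last lia.
by rewrite nth_rev; [congr nth|]; lia.
Qed.

(** * The rightward sweep as a transducer *)

Section WindowTransducer.
Variables (S : finType) (m : nat) (chi : m.+1.-tuple S -> m.+1.-tuple S).
Implicit Types (x y z : config S) (W : m.+1.-tuple S).

(* The state is the window before [chi] is applied to it; the input letter is the
   symbol entering on the right, the output is the first letter of [chi W]. *)
Definition window_step W (a : S) : m.+1.-tuple S := [tuple of rcons (behead (chi W)) a].

(** The output and the next state together spell [chi W] followed by [a]. *)
Lemma window_step_inj : injective chi ->
  injective (fun Wa => (thead (chi Wa.1), window_step Wa.1 Wa.2)).
Proof.
move=> chi_inj [W a] [W' a'] /= [hd /rcons_inj[tl ->]]; congr pair; apply: chi_inj.
move: hd tl; case/tupleP: (chi W) => b t; case/tupleP: (chi W') => b' t'.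
by rewrite !theadE /= => -> tt; apply/val_inj; rewrite /= tt.
Qed.

Lemma window_step_apply_at x i :
  window_step (window m.+1 x i) (x (i + m.+1%:Z)) =
  window m.+1 (apply_at chi i x) (i + 1).
Proof.
apply: eq_from_tnth => k; rewrite tnth_mktuple (tnth_nth (x i)) /= nth_rcons.
rewrite size_behead size_tuple /=.
have [km|] := ltnP k m.
  rewrite nth_behead /apply_at ifT; last lia.
  have -> : `|(i + 1 + k%:Z - i)%R|%N = k.+1 by lia.
  by apply: set_nth_default; rewrite size_tuple.
have := ltn_ord k => km mk; rewrite ifT; last by apply/eqP; lia.
rewrite apply_at_out; last lia.
by congr (x _); lia.
Qed.

Lemma sweep_right_out x i p j : i + p%:Z + m%:Z <= j -> sweep_right chi i x p j = x j.
Proof. by elim: p => [//|p IH] jp /=; rewrite apply_at_out ?IH //; lia. Qed.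

Lemma window_sweep_right x i p :
  window m.+1 (sweep_right chi i x p) (i + p%:Z) =
  foldl window_step (window m.+1 x i) (segment x (i + m.+1%:Z) p).
Proof.
elim: p => [|p IH]; first by rewrite addr0.
rewrite -[in RHS](addn1 p) segmentD foldl_cat -IH /=.
rewrite -(@sweep_right_out x i p); last lia.
rewrite (_ : i + m.+1%:Z + p%:Z + 0 = i + p%:Z + m.+1%:Z); last lia.
rewrite window_step_apply_at; congr window; lia.
Qed.

Lemma sweep_right_lim_thead x i p :
  sweep_right_lim chi i x (i + p%:Z) =
  thead (chi (foldl window_step (window m.+1 x i) (segment x (i + m.+1%:Z) p))).
Proof.
rewrite (@sweep_right_limE _ _ _ _ _ _ p.+1); last lia.
rewrite /= -window_sweep_right /thead (tnth_nth (sweep_right chi i x p (i + p%:Z))).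
rewrite /apply_at ifT; last lia.
by rewrite subrr.
Qed.

Lemma sweeper_graph_window (f : config S -> config S) y (j c : int) :
  injective chi -> sweeper_relation chi = graph f ->
  (forall x, (forall l, c + m.+1%:Z <= l -> x l = y l) -> f x j = f y j) ->
  forall p, j = c + p%:Z -> forall W : m.+1.-tuple S,
  thead (chi (foldl window_step W (segment y (c + m.+1%:Z) p))) = f y j.
Proof.
move=> chi_inj swf fy p jE; set v := segment _ _ _ => W0.
pose bad := [set W | thead (chi (foldl window_step W v)) != f y j]%SET.
apply/eqP; apply: contraT => W0bad.
have [|w0 w0P] := @persistent_word _ _ _ (fun W _ => thead (chi W))
    (window_step_inj chi_inj) bad.
  by apply/set0Pn; exists W0; rewrite inE.
pose a : S := thead W0.
have [g gP] := choice w0P.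
(* The starting state [g (V t)] is itself written to the left of the word [V t ++ w0] that it reads:
   a sweep starting there begins in that state and is bad at [c]. *)
pose V := fix V t := if t is t'.+1 then (g (V t') : seq S) ++ V t' else [::].
pose w t := V t ++ w0; pose s t : seq S := g (V t).
have wS t : w t.+1 = s t ++ w t by rewrite /w /s /= -catA.
have s0 t : (0 < size (s t))%N by rewrite /s size_tuple.
have [x [xy xw]] := left_infinite_word a (c + m.+1%:Z) y wS s0.
have wrong t : sweep_right_lim chi (c + m.+1%:Z - (size (w t.+1))%:Z) x j != f x j.
  set i := (X in sweep_right_lim _ X).
  pose q := size (w t).
  have sz : size (w t.+1) = (m.+1 + q)%N by rewrite wS size_cat size_tuple.
  have := xw t.+1; rewrite -/i sz segmentD.
  have -> : i = c - q%:Z by rewrite /i sz; lia.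
  rewrite wS /s => /eqP; rewrite eqseq_cat; last first.
    by rewrite size_segment size_tuple.
  move=> /andP[/eqP xg /eqP xq].
  have -> : j = c - q%:Z + (q + p)%N%:Z by lia.
  rewrite sweep_right_lim_thead segmentD xq.
  have -> : window m.+1 x (c - q%:Z) = g (V t).
    by apply/val_inj; exact: etrans (window_segment _ _ _) xg.
  have -> : c - q%:Z + m.+1%:Z + q%:Z = c + m.+1%:Z by lia.
  rewrite (eq_segment _ xy) -/v foldl_cat.
  have := gP (V t); rewrite inE /w /= => h.
  rewrite (_ : c - q%:Z + (q + p)%N%:Z = j); last lia.
  by rewrite (fy x xy).
(* Dropping the first [T] words makes every starting point nonpositive, hence of the form
   [- (k t)]. *)
pose T := `|(c + m.+1%:Z)%R|%N.
have size_w := leq_size_extension wS s0.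
pose k t := `|((size (w (t + T).+1))%:Z - (c + m.+1%:Z))%R|%N.
have kE t : - (k t)%:Z = c + m.+1%:Z - (size (w (t + T).+1))%:Z.
  by have := size_w (t + T).+1; rewrite /k /T; lia.
have kP : {homo k : t u / (t < u)%N}.
  apply: homo_ltn; first exact: ltn_trans.
  move=> t; have := kE t; have := kE t.+1; rewrite addSn [w (t + T).+2]wS size_cat.
  by have := s0 (t + T).+1; lia.
have [psi _ [z]] := sweeper_subseq chi x kP.
rewrite swf /graph /= => -> /config_cvgP /(_ j) [N _ /(_ N (leqnn N))] /=.
by rewrite kE => E; have := wrong (psi N + T)%N; rewrite E eqxx.
Qed.

Lemma sweeper_graph_slider (f : config S -> config S) (chi_bij : bijective chi) :
  continuous f -> sweeper_relation chi = graph f ->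
  slider_relation chi_bij `<=` graph f.
Proof.
move=> fc swf [y z] [x [i /= [yE zE]]]; rewrite /graph /=; apply/funext => j.
have [r fy] := config_continuous_tail fc y j.
pose q := (`|i|+ `|j| + r + m.+1)%N; pose xi := inverse_rule chi_bij.
(* The size of [q] ensures [c <= j] and [c + m.+1 <= - r]. From [c + m.+1] on, [yq] already equals
   [y]; its window at [c] is unknown, but no state there is bad. *)
pose yq := sweep_left xi i x q; pose c := i - q%:Z.
have zE' : z = sweep_right_lim chi c yq.
  rewrite (sweep_right_limD _ _ _ q) sweep_leftK; last exact: f_invF.
  by rewrite -zE; congr sweep_right_lim; lia.
have jE : j = c + `|j - c|%N%:Z by lia.
rewrite zE' [in LHS]jE sweep_right_lim_thead.
have -> : segment yq (c + m.+1%:Z) `|j - c|%N = segment y (c + m.+1%:Z) `|j - c|%N.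
  apply: eq_segment => l cl; rewrite -yE.
  by rewrite (@sweep_left_limE _ _ _ _ _ _ q) //; rewrite /c in cl; lia.
apply: sweeper_graph_window (bij_inj chi_bij) swf _ _ jE _.
by move=> x' x'y; apply: fy => l rl; apply: x'y; rewrite /c /q; lia.
Qed.

End WindowTransducer.

Theorem theorem28 (S : finType) (n : nat) (chi : n.-tuple S -> n.-tuple S)
    (f : config S -> config S)
    (S_nonempty : (0 < #|S|)%N) (n_pos : (0 < n)%N)
    (chi_bij : bijective chi) (f_ca : cellular_automaton f) :
  slider_relation chi_bij = graph f <-> sweeper_relation chi = graph f.
Proof.
case: n chi n_pos chi_bij => // m chi _ chi_bij.
have sub := @sweeper_sub_slider _ _ _ chi_bij.
split=> [slf|swf]; apply/seteqP; split.
- by rewrite -slf.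
- move=> [y z] yz; have [z' yz'] := sweeper_total chi y.
  have := sub _ yz'; rewrite slf /graph /= => z'E.
  by move: yz; rewrite /graph /= -z'E => ->.
- exact: sweeper_graph_slider f_ca.1 swf.
- by rewrite -swf.
Qed.
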